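(* Let $f:\mathbb{R}^n\to\mathbb{R}^n$ be differentiable and suppose that the autonomous system $\frac{dy}{dt}=f(y)$ has a finite number of equilibria and that $\mathrm{Re}(\lambda)\neq 0$ for every $\lambda\in\Omega$, where $\Omega=\bigcup_{y^*\in\Gamma}\sigma(J(y^* ))$, $\Gamma$ is the set of all equilibria of the system, and $\sigma(J(y^* ))$ is the set of eigenvalues of the Jacobian matrix $J(y^* )$ of $f$ at $y^*$. Let $(A,b^T,h)$ be an $s$-stage explicit standard Runge-Kutta method whose order of accuracy is $p=s$. Then there exists a number $\varphi^*=\varphi^*(p,\Omega)>0$, depending only on $p$ and $\Omega$, such that the explicit nonstandard Runge-Kutta method $(A,b^T,\varphi)$ is elementary stable for the system whenever the denominator function $\varphi$ satisfies $$0<\varphi(h)<\varphi^*\qquad\text{for all } h>0.$$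
   Context: Let $s\ge 1$, let $A=(a_{ij})_{s\times s}$ be a real matrix with $a_{ij}=0$ for $j\ge i$, and let $b=(b_1,\ldots,b_s)\in\mathbb{R}^s$. Let $\varphi$ be a function of the step size $h>0$ with $\varphi(h)=h+\mathcal{O}(h^2)$ as $h\to 0$ (the denominator function). The explicit nonstandard Runge-Kutta (ENRK) method $(A,b^T,\varphi)$ for the system $\frac{dy}{dt}=f(y)$ with step size $h>0$ is the one-step scheme $$K_1=f(y_k),\quad K_i=f\Big(y_k+\varphi(h)\sum_{j=1}^{i-1}a_{ij}K_j\Big)\ (2\le i\le s),\qquad \frac{y_{k+1}-y_k}{\varphi(h)}=b_1K_1+\cdots+b_sK_s .$$ The choice $\varphi(h)=h$ gives the explicit standard Runge-Kutta (ESRK) method $(A,b^T,h)$. The order of accuracy of an ESRK method is its classical order: the method has order at least $p$ if for every sufficiently smooth $f$ the local error after one step starting from an exact value is $\mathcal{O}(h^{p+1})$ as $h\to0$; its order is the largest such $p$ (assumed $\ge 1$). An equilibrium of the system is a point $y^*$ with $f(y^* )=0$. An equilibrium $y^*$ of the system is linearly stable if all eigenvalues $\lambda$ of $J(y^* )$ satisfy $\mathrm{Re}(\lambda)<0$, and linearly unstable if some eigenvalue of $J(y^* )$ has $\mathrm{Re}(\lambda)>0$. Let $\hat J(y^* )$ be the Jacobian at $y^*$ of the map $y_k\mapsto y_{k+1}$ defined by the scheme. A fixed point $y^*$ of the scheme is linearly stable if all eigenvalues $\mu$ of $\hat J(y^* )$ satisfy $|\mu|<1$, and linearly unstable if some eigenvalue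 has $|\mu|>1$. The scheme is called elementary stable if it preserves the linear stability of the equilibria of the system for every step size: for every $h>0$, each equilibrium $y^*$ of the system is a fixed point of the scheme, and it is linearly stable (respectively linearly unstable) for the scheme if it is linearly stable (respectively linearly unstable) for the system. *)

(* Defs.v *)
From HB Require Import structures.
From mathcomp Require Import all_boot all_order all_algebra.
From mathcomp Require Import all_classical all_reals all_analysis.
From mathcomp Require Import complex.

Set Implicit Arguments.
Unset Strict Implicit.
Unset Printing Implicit Defensive.

Import Order.TTheory GRing.Theory Num.Theory.
Import numFieldNormedType.Exports.

Local Open Scope classical_set_scope.
Local Open Scope ring_scope.
Local Open Scope complex_scope.

(* Points of R^n are row vectors; the library
   Jacobian 'J g y acts on row vectors from the right, i.e. it is the transpose
   of the usual column-convention Jacobian and has the same eigenvalues. *)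

Section Scheme.
Variables (R : realType) (n s : nat).
Variables (A : 'M[R]_s) (b : 'rV[R]_s) (phi : R -> R).
Variables (f : 'rV[R]_n -> 'rV[R]_n) (h : R) (y : 'rV[R]_n).

(* Recursion on the fuel m; stage i depends only on stages j < i, so any fuel
   m > i gives the same value, and enrk_stage uses m = s.  The defining equation
   of the stages is enrk_stageE. *)
Fixpoint enrk_stage_rec (m : nat) (i : 'I_s) : 'rV[R]_n :=
  if m is m'.+1 then
    f (y + phi h *: \sum_(j < s | (j < i)%N) A i j *: enrk_stage_rec m' j)
  else 0.

Definition enrk_stage (i : 'I_s) : 'rV[R]_n := enrk_stage_rec s i.

Lemma enrk_stage_recE m (i : 'I_s) :
  (i < m)%N -> enrk_stage_rec m i = enrk_stage i.
Proof.
suff H k (j : 'I_s) : (j < k)%N -> forall k', (j < k')%N ->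
    enrk_stage_rec k j = enrk_stage_rec k' j.
  by move=> im; apply: H.
elim: k j => [//|k IH] j jk [//|k'] jk' /=.
congr (f (y + _ *: _)); apply: eq_bigr => l lj; congr (_ *: _).
by apply: IH; apply: leq_trans lj _.
Qed.

Lemma enrk_stageE (i : 'I_s) :
  enrk_stage i =
  f (y + phi h *: \sum_(j < s | (j < i)%N) A i j *: enrk_stage j).
Proof.
rewrite -(@enrk_stage_recE i.+1 i) //=.
congr (f (y + _ *: _)); apply: eq_bigr => j ji.
by rewrite enrk_stage_recE.
Qed.

Definition enrk_step : 'rV[R]_n :=
  y + phi h *: \sum_(i < s) b 0 i *: enrk_stage i.

End Scheme.

Definition explicit_tableau (R : realType) (s : nat) (A : 'M[R]_s) : Prop :=
  forall i j : 'I_s, (i <= j)%N -> A i j = 0.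

Definition denominator_function (R : realType) (phi : R -> R) : Prop :=
  (fun h : R => phi h - h) =O_ (0^'+) (fun h : R => h ^+ 2).

Definition esrk_step (R : realType) (n s : nat) (A : 'M[R]_s) (b : 'rV[R]_s)
    (f : 'rV[R]_n -> 'rV[R]_n) (h : R) (y : 'rV[R]_n) : 'rV[R]_n :=
  enrk_step A b id f h y.

Fixpoint class_C (R : realType) (n k : nat) (g : 'rV[R]_n -> 'rV[R]_n) : Prop :=
  continuous g /\
  if k is k'.+1 then
    forall i : 'I_n, (forall y, derivable g y (delta_mx 0 i)) /\
                     class_C k' (fun y => 'D_(delta_mx 0 i) g y)
  else True.

(* "For every sufficiently smooth f" is read as: for some k, for all f of class
   C^k, in every dimension.  By autonomy the exact value is taken at time 0. *)
Definition order_at_least (R : realType) (s : nat)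
    (A : 'M[R]_s) (b : 'rV[R]_s) (p : nat) : Prop :=
  exists k : nat, forall (n : nat) (f : 'rV[R]_n -> 'rV[R]_n), class_C k f ->
  forall u : R -> 'rV[R]_n,
    (\forall t \near (0 : R), is_derive (t : R) (1 : R) u (f (u t))) ->
    (fun h : R => u h - esrk_step A b f h (u 0))
      =O_ (0^'+) (fun h : R => h ^+ p.+1).

Definition has_order (R : realType) (s : nat)
    (A : 'M[R]_s) (b : 'rV[R]_s) (p : nat) : Prop :=
  order_at_least A b p /\
  forall q : nat, order_at_least A b q -> (q <= p)%N.

Section Stability.
Variables (R : realType) (n : nat).
Implicit Types (f g : 'rV[R]_n -> 'rV[R]_n) (y : 'rV[R]_n).

Definition equilibria f : set 'rV[R]_n := [set y | f y = 0].

Definition jac_spectrum g y : set R[i] :=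
  [set lambda | eigenvalue (map_mx (real_complex R) ('J g y)) lambda].

Definition equilibria_spectrum f : set R[i] :=
  \bigcup_(y in equilibria f) jac_spectrum f y.

Definition ode_linearly_stable f y : Prop :=
  forall lambda, jac_spectrum f y lambda -> complex.Re lambda < 0.

Definition ode_linearly_unstable f y : Prop :=
  exists2 lambda, jac_spectrum f y lambda & 0 < complex.Re lambda.

Definition map_linearly_stable g y : Prop :=
  forall mu, jac_spectrum g y mu -> `|mu| < 1.

Definition map_linearly_unstable g y : Prop :=
  exists2 mu, jac_spectrum g y mu & 1 < `|mu|.

Definition elementary_stable f (step : R -> 'rV[R]_n -> 'rV[R]_n) : Prop :=
  forall h : R, 0 < h -> forall y, equilibria f y ->
    [/\ step h y = y,
        ode_linearly_stable f y -> map_linearly_stable (step h) y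
      & ode_linearly_unstable f y -> map_linearly_unstable (step h) y].

End Stability.

(* Main.v *)
Require Import Defs.
From mathcomp Require Import all_boot all_order all_algebra.
From mathcomp Require Import all_classical all_reals all_analysis.
From mathcomp Require Import complex.
From mathcomp Require Import ring lra.
Import Order.TTheory GRing.Theory Num.Theory.
Import numFieldNormedType.Exports.
Local Open Scope classical_set_scope.
Local Open Scope ring_scope.
Local Open Scope complex_scope.

(** At an equilibrium y every stage vanishes, so y is a fixed point of the
scheme.  Differentiating the stages there, the Jacobian of one step is
P(phi(h) J), where J is the Jacobian of f and P, the stability polynomial,
depends on the tableau alone and has degree at most s, because each of the s
nested stages contributes at most one factor J.

The order hypothesis determines P.  On the scalar equation u' = u one step of
the standard method multiplies by P(h), while the exact flow multiplies by
exp h.  Order s means that P(h) = exp h + O(h^(s+1)), so P and the Taylor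
polynomial T_s of exp of degree s differ by a polynomial that has degree at most
s and is O(h^(s+1)); they are equal ([stability_poly_exp]).  So the tableau
influences the linearization only through p = s, which is why the threshold can
be chosen from p and the spectrum alone.

By the spectral mapping theorem ([horner_mx_spectrum]) the eigenvalues of the
linearized scheme are the numbers T_p(phi(h) lambda) with lambda an eigenvalue
of J.  As T_p(z) = 1 + z + O(z^2), for small t > 0 the number |T_p(t lambda)| is
below or above 1 according to whether Re lambda is negative or positive
([taylor_exp_modulus]).  Finitely many equilibria have finitely many eigenvalues
altogether, so a single bound on t = phi(h) serves them all. *)

Set Implicit Arguments.
Unset Strict Implicit.
Unset Printing Implicit Defensive.

(** * The stability polynomial of an explicit tableau *)

(** For f(v) = v J the i-th stage is v S(phi J) J, where S is the i-th stage
polynomial.  The fuel m is that of the stages, so that stages and polynomials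
are compared by one induction. *)
Fixpoint stage_poly (R : realType) (s : nat) (A : 'M[R]_s) (m : nat)
    (i : 'I_s) : {poly R} :=
  if m is m'.+1 then
    1 + 'X * \sum_(j < s | (j < i)%N) A i j *: stage_poly A m' j
  else 0.

Definition stability_poly (R : realType) (s : nat) (A : 'M[R]_s)
    (b : 'rV[R]_s) : {poly R} :=
  1 + 'X * \sum_(i < s) b 0 i *: stage_poly A s i.

Lemma size_stage_poly (R : realType) (s : nat) (A : 'M[R]_s) m i :
  (size (stage_poly A m i) <= m)%N.
Proof.
elim: m i => [|m IH] i /=; first by rewrite size_poly0.
rewrite (leq_trans (size_polyD _ _))// geq_max size_poly1 /=.
rewrite (leq_trans (size_polyMleq _ _))// size_polyX /= ltnS.
apply: (leq_trans (size_sum _ _ _)); apply/bigmax_leqP => j _.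
by rewrite (leq_trans (size_scale_leq _ _)).
Qed.

Lemma size_stability_poly (R : realType) (s : nat) (A : 'M[R]_s)
    (b : 'rV[R]_s) :
  (size (stability_poly A b) <= s.+1)%N.
Proof.
rewrite (leq_trans (size_polyD _ _))// geq_max size_poly1 /=.
rewrite (leq_trans (size_polyMleq _ _))// size_polyX /= ltnS.
apply: (leq_trans (size_sum _ _ _)); apply/bigmax_leqP => j _.
by rewrite (leq_trans (size_scale_leq _ _))// size_stage_poly.
Qed.

Lemma enrk_stage_rec_id (R : realType) (n s : nat) (A : 'M[R]_s) phi h
    (y : 'rV[R]_n) m i :
  enrk_stage_rec A phi id h y m i = (stage_poly A m i).[phi h] *: y.
Proof.
elim: m i => [|m IH] i /=; first by rewrite horner0 scale0r.
rewrite !hornerE horner_sum scalerDl scale1r -scalerA scaler_suml.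
congr (y + _ *: _).
by apply: eq_bigr => j _; rewrite IH hornerZ scalerA.
Qed.

Lemma enrk_step_id (R : realType) (n s : nat) (A : 'M[R]_s) b phi h
    (y : 'rV[R]_n) :
  enrk_step A b phi id h y = (stability_poly A b).[phi h] *: y.
Proof.
rewrite /enrk_step /stability_poly !hornerE horner_sum scalerDl scale1r.
rewrite -scalerA scaler_suml.
congr (y + _ *: _).
by apply: eq_bigr => j _; rewrite /enrk_stage enrk_stage_rec_id hornerZ scalerA.
Qed.

(** * Linearization at an equilibrium *)

Section Equilibrium.
Variables (R : realType) (n s : nat) (A : 'M[R]_s) (b : 'rV[R]_s).
Variables (phi : R -> R) (h : R) (f : 'rV[R]_n -> 'rV[R]_n) (y : 'rV[R]_n).
Hypothesis fy : f y = 0.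

Lemma stage_at_equilibrium m i : enrk_stage_rec A phi f h y m i = 0.
Proof.
elim: m i => [//|m IH] i /=; rewrite big1 ?scaler0 ?addr0// => j _.
by rewrite IH scaler0.
Qed.

Lemma step_at_equilibrium : enrk_step A b phi f h y = y.
Proof.
rewrite /enrk_step big1 ?scaler0 ?addr0// => i _.
by rewrite /enrk_stage stage_at_equilibrium scaler0.
Qed.

End Equilibrium.

Lemma is_diff_sumZ (K : numFieldType) (V W : normedModType K) (I : finType)
    (P : pred I) (c : I -> K) (F dF : I -> V -> W) x :
  (forall i, is_diff x (F i) (dF i)) ->
  is_diff x (fun y => \sum_(i | P i) c i *: F i y)
    (fun v => \sum_(i | P i) c i *: dF i v).
Proof.
move=> FdF.
have sumE (G : I -> V -> W) :
    (fun y => \sum_(i | P i) c i *: G i y) = \sum_(i | P i) (c i *: G i).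
  by apply/funext => y; rewrite fct_sumE.
rewrite !sumE; elim/big_ind2 : _ => [|f df g dg fP gP|i _].
- exact: is_diff_cst.
- exact: is_diffD.
- exact: is_diffZ.
Qed.

Section Linearization.
Variables (R : realType) (n s : nat) (A : 'M[R]_s) (b : 'rV[R]_s).
Variables (phi : R -> R) (h : R).
Variables (f : 'rV[R]_n.+1 -> 'rV[R]_n.+1) (y : 'rV[R]_n.+1).
Hypotheses (fy : f y = 0) (dfy : differentiable f y).

Let J := 'J f y.

Let is_diff_f : is_diff y f (mulmx^~ J).
Proof.
apply: DiffDef => //; apply/funext => v.
by rewrite /J -deriveEjacobian// deriveE.
Qed.

(** The shape common to the argument of a stage and to the whole step: the
factor phi h and the trailing J of each stage make up one factor 'X. *)
Let horner_affine (v : 'rV[R]_n.+1) (P : pred 'I_s) (c : 'I_s -> R)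
    (S : 'I_s -> {poly R}) :
  v + phi h *: \sum_(j < s | P j)
                 c j *: (v *m (horner_mx (phi h *: J) (S j) *m J)) =
  v *m horner_mx (phi h *: J) (1 + 'X * \sum_(j < s | P j) c j *: S j).
Proof.
rewrite mulrC rmorphD rmorph1 rmorphM /= horner_mx_X rmorph_sum /=.
rewrite mulmxDr mulmx1.
congr (v + _).
rewrite -[_ * _]/(_ *m _) -!scalemxAr; congr (_ *: _).
rewrite mulmx_suml mulmx_sumr; apply: eq_bigr => j _.
by rewrite linearZ -scalemxAl -scalemxAr.
Qed.

Lemma is_diff_stage m i :
  is_diff y (fun z => enrk_stage_rec A phi f h z m i)
    (fun v => v *m (horner_mx (phi h *: J) (stage_poly A m i) *m J)).
Proof.
elim: m i => [|m IH] i /=.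
  rewrite rmorph0 mul0mx (_ : (fun v => v *m 0) = 0); first exact: is_diff_cst.
  by apply/funext => v; rewrite mulmx0.
set g := fun z => z + phi h *:
  \sum_(j < s | (j < i)%N) A i j *: enrk_stage_rec A phi f h z m j.
(* The chain rule uses the derivative of f at g y, which must therefore be y. *)
have gy : g y = y.
  rewrite /g big1 ?scaler0 ?addr0// => j _.
  by rewrite (stage_at_equilibrium A phi h fy) scaler0.
have dg : is_diff y g (mulmx^~ (horner_mx (phi h *: J)
      (1 + 'X * \sum_(j < s | (j < i)%N) A i j *: stage_poly A m j))).
  apply: (is_diff_eq (is_diffD (is_diff_id y) (is_diffZ (phi h)
    (is_diff_sumZ (fun j : 'I_s => (j < i)%N) (A i) IH)))).
  by apply/funext => v; exact: horner_affine.
have dfg : is_diff (g y) f (mulmx^~ J) by rewrite gy.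
apply: (is_diff_eq (is_diff_comp dg dfg)).
by apply/funext => v /=; rewrite mulmxA.
Qed.

Lemma is_diff_step :
  is_diff y (enrk_step A b phi f h)
    (mulmx^~ (horner_mx (phi h *: J) (stability_poly A b))).
Proof.
apply: (is_diff_eq (is_diffD (is_diff_id y)
  (is_diffZ (phi h) (is_diff_sumZ xpredT (b 0) (is_diff_stage s))))).
by apply/funext => v; exact: horner_affine.
Qed.

Lemma jacobian_step :
  'J (enrk_step A b phi f h) y = horner_mx (phi h *: J) (stability_poly A b).
Proof.
have dstep := is_diff_step.
apply/row_matrixP => i; rewrite !rowE -deriveEjacobian; last exact: ex_diff.
by rewrite deriveE ?diff_val//; exact: ex_diff.
Qed.

End Linearization.

(** * Order s forces the stability polynomial to be the truncated exponential *)

Definition taylor_exp (F : fieldType) (p : nat) : {poly F} :=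
  \poly_(k < p.+1) (k`!%:R)^-1.

Lemma series_exp_le (R : realType) (h : R) N :
  0 <= h -> series (exp_coeff h) N <= expR h.
Proof.
move=> h0; apply: nondecreasing_cvgn_le; last exact: is_cvg_series_exp_coeff.
apply/nondecreasing_seqP => n.
by rewrite /series/= big_nat_recr//= lerDl exp_coeff_ge0.
Qed.

Lemma horner_taylor_exp (R : realType) (h : R) p :
  (taylor_exp R p).[h] = series (exp_coeff h) p.+1.
Proof.
rewrite horner_poly /series /= big_mkord.
by apply: eq_bigr => k _; rewrite mulrC.
Qed.

(** The tail of the exponential series after degree p is dominated, term by
term, by h^(p+1) times the whole series, since (p+1+k)! >= k!. *)
Lemma expR_taylor_error (R : realType) (h : R) p : 0 <= h ->
  `|expR h - (taylor_exp R p).[h]| <= h ^+ p.+1 * expR h.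
Proof.
move=> h0; rewrite horner_taylor_exp ger0_norm ?subr_ge0 ?series_exp_le//.
rewrite lerBlDr addrC.
suff shift N : series (exp_coeff h) (p.+1 + N) <=
    series (exp_coeff h) p.+1 + h ^+ p.+1 * expR h.
  rewrite {1}/expR; apply: limr_le; first exact: is_cvg_series_exp_coeff.
  near=> N; have -> : N = (p.+1 + (N - p.+1))%N.
    by rewrite subnKC//; near: N; exact: nbhs_infty_ge.
  exact: shift.
rewrite {1}/series /= (@big_cat_nat _ _ _ p.+1) ?leq_addr//= lerD2l.
rewrite (le_trans _ (ler_wpM2l (exprn_ge0 p.+1 h0) (series_exp_le N h0)))//.
rewrite /series /= -{1}[p.+1]add0n big_addn addKn mulr_sumr.
apply: ler_sum_nat => k _.
rewrite /exp_coeff /= exprD mulrA [h ^+ p.+1 * _]mulrC.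
rewrite ler_wpM2l ?mulr_ge0 ?exprn_ge0//.
by rewrite lef_pV2 ?posrE ?ltr0n ?fact_gt0// ler_nat leq_fact// leq_addr.
Unshelve. all: by end_near. Qed.

(** Induction on m: once 'X^m has been factored out, the cofactor is O(h), so
by continuity it vanishes at 0 and yields one more factor 'X. *)
Lemma dvdXn_bigO (R : realType) (q : {poly R}) (m : nat) (C : R) :
  (\forall h \near 0^'+, `|q.[h]| <= C * h ^+ m) -> 'X^m %| q.
Proof.
elim: m C => [|m IH] C Oq; first by rewrite expr0 dvd1p.
have /dvdpP[r qE] : 'X^m %| q.
  apply: (IH `|C|); near=> h.
  have h0 : 0 < h by near: h; exact: nbhs_right_gt.
  have h1 : h <= 1 by near: h; exact: nbhs_right_le.
  have /le_trans -> // : `|q.[h]| <= C * h ^+ m.+1 by near: h.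
  rewrite (le_trans (ler_norm _))// normrM ler_wpM2l//.
  rewrite (ger0_norm (exprn_ge0 _ (ltW h0))).
  by rewrite exprS ler_piMl// exprn_ge0// ltW.
suff /factor_theorem[r' r'E] : root r 0.
  by rewrite qE r'E subr0 -mulrA -exprS dvdp_mull.
have r0 : r.[h] @[h --> 0^'+] --> r.[0].
  by apply: cvg_at_right_filter; exact: continuous_horner.
have Ch : C * h @[h --> 0^'+] --> C * 0.
  by apply: cvgM; [exact: cvg_cst | exact: cvg_at_right_filter].
apply/rootP/eqP; rewrite -normr_le0 -[leRHS](mulr0 C).
apply: (ler_cvg_to (cvg_norm r0) Ch); near=> h.
have h0 : 0 < h by near: h; exact: nbhs_right_gt.
have : `|q.[h]| <= C * h ^+ m.+1 by near: h.
rewrite qE hornerM hornerXn normrM (ger0_norm (exprn_ge0 _ (ltW h0))).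
by rewrite exprS mulrA ler_pM2r ?exprn_gt0.
Unshelve. all: by end_near. Qed.

Lemma class_C_cst (R : realType) n k (c : 'rV[R]_n) :
  class_C k (fun _ : 'rV[R]_n => c).
Proof.
elim: k c => [|k IH] c /=; split => //; try exact: cst_continuous.
move=> i; split=> [y|]; first exact: derivable_cst.
rewrite (_ : (fun y => 'D_(delta_mx 0 i) (fun=> c) y) = fun=> 0).
  exact: IH.
by apply/funext => y; exact: derive_cst.
Qed.

Lemma class_C_id (R : realType) n k : class_C k (@id 'rV[R]_n).
Proof.
case: k => [|k] /=; split => //; try by move=> x; exact: cvg_id.
move=> i; split=> [y|]; first exact: derivable_id.
rewrite (_ : (fun y => 'D_(delta_mx 0 i) id y) = fun=> delta_mx 0 i).
  exact: class_C_cst.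
by apply/funext => y; exact: derive_id.
Qed.

Lemma is_derive_expRZ (R : realType) (V : normedModType R) (v : V) (t : R) :
  is_derive t (1 : R) (fun t => expR t *: v) (expR t *: v).
Proof.
have dE : is_diff t (expR : R -> R) ( *:%R^~ (expR t)).
  apply: DiffDef; first by apply/derivable1_diffP.
  rewrite diff1E; last by apply/derivable1_diffP.
  by rewrite derive1E derive_val.
have du := is_diff_comp dE (is_diff_scalel (expR t) v).
have du' : differentiable ( *:%R^~ v \o expR) t by exact: ex_diff.
apply: DeriveDef; first exact: diff_derivable.
by rewrite deriveE// diff_val /= scale1r.
Qed.

(** The order condition is tested on the single scalar problem u' = u, u(0) = 1,
where one step is multiplication by the stability polynomial.  The difference
from the Taylor polynomial is then divisible by 'X^(s.+1) and has size at most
s.+1, so it is 0. *)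
Lemma stability_poly_exp (R : realType) (s : nat) (A : 'M[R]_s)
    (b : 'rV[R]_s) :
  order_at_least A b s -> stability_poly A b = taylor_exp R s.
Proof.
move=> [k /(_ 1%N id (class_C_id _ _ _)) ord].
pose u (t : R) : 'rV[R]_1 := expR t *: const_mx 1.
have /eqO_exP[C C0 HC] : (fun h : R => u h - esrk_step A b id h (u 0))
    =O_ (0^'+) (fun h : R => h ^+ s.+1).
  by apply: ord; near=> t; exact: is_derive_expRZ.
have : 'X^(s.+1) %| stability_poly A b - taylor_exp R s.
  pose c := `|const_mx 1 : 'rV[R]_1|.
  have c0 : 0 < c.
    rewrite normr_gt0; apply/eqP => /matrixP/(_ 0 0)/eqP.
    by rewrite !mxE oner_eq0.
  apply: (@dvdXn_bigO _ _ _ (C / c + expR 1)); near=> h.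
  have h0 : 0 < h by near: h; exact: nbhs_right_gt.
  have h1 : h <= 1 by near: h; exact: nbhs_right_le.
  have uh : `|expR h - (stability_poly A b).[h]| <= C / c * h ^+ s.+1.
    have : `|u h - esrk_step A b id h (u 0)| <= C * `|h ^+ s.+1|.
      by near: h.
    rewrite /u /esrk_step enrk_step_id expR0 scale1r -scalerBl normrZ.
    by rewrite (ger0_norm (exprn_ge0 _ (ltW h0))) mulrAC ler_pdivlMr.
  have := expR_taylor_error s (ltW h0).
  rewrite hornerD hornerN mulrDl => Te.
  have {}Te : `|expR h - (taylor_exp R s).[h]| <= expR 1 * h ^+ s.+1.
    by rewrite (le_trans Te)// mulrC ler_wpM2r ?exprn_ge0 ?(ltW h0)// ler_expR.
  rewrite (le_trans _ (lerD uh Te))// [in leRHS]distrC.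
  by rewrite -[X in `|X| <= _](subrKA (expR h)) ler_normD.
move=> /dvdp_leq dvd; apply/eqP; rewrite -subr_eq0; apply: contraT => /dvd.
rewrite size_polyXn ltnNge (leq_trans (size_polyD _ _))// size_polyN geq_max.
by rewrite size_stability_poly size_poly.
Unshelve. all: by end_near. Qed.

(** * Spectral mapping for polynomials in a matrix *)

(** If mu is an eigenvalue of p(M), then p - mu shares a root with the minimal
polynomial of M: otherwise a Bezout relation would make p(M) - mu invertible. *)
Lemma horner_mx_spectrum (F : closedFieldType) n (M : 'M[F]_n.+1)
    (p : {poly F}) mu :
  eigenvalue (horner_mx M p) mu <->
  exists2 lambda, eigenvalue M lambda & p.[lambda] = mu.
Proof.
split=> [/eigenvalueP[v vp v0]|[l /eigenvalueP[v vM v0] <-]].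
  have vq : v *m horner_mx M (p - mu%:P) = 0.
    by rewrite rmorphB /= horner_mx_C mulmxBr vp mul_mx_scalar subrr.
  have /Pdiv.ClosedField.coprimepP : ~~ coprimep (mxminpoly M) (p - mu%:P).
    apply/negP => /Bezout_eq1_coprimepP [[u w]] /= /(congr1 (horner_mx M)).
    rewrite rmorphD !rmorphM /= mx_root_minpoly mulr0 add0r rmorph1 => uw.
    move: v0; rewrite -[v]mulmx1 -[1%:M]/1 -uw.
    by rewrite (comm_horner_mx2 M w) -mulmxE mulmxA vq mul0mx eqxx.
  move=> nroot; apply: contrapT => nol; apply: nroot => l lM.
  apply: contra_notN nol; rewrite !hornerE subr_eq0 => /eqP pl.
  by exists l => //; rewrite eigenvalue_root_min.
apply/eigenvalueP; exists v => //.
elim/poly_ind: p => [|p c IH]; first by rewrite horner0 rmorph0 mulmx0 scale0r.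
rewrite rmorphD rmorphM /= horner_mx_X horner_mx_C mulmxDr -mulmxE mulmxA IH.
by rewrite -scalemxAl vM mul_mx_scalar !hornerE scalerDl scalerA mulrC.
Qed.

Lemma eigenvalueZ (F : fieldType) n (M : 'M[F]_n) (c l : F) : c != 0 ->
  eigenvalue (c *: M) (c * l) = eigenvalue M l.
Proof.
move=> c0; apply/eigenvalueP/eigenvalueP => -[v vM v0]; exists v => //.
  apply: (scalerI c0); rewrite scalerA -vM.
  by rewrite -scalemxAr.
by rewrite -scalemxAr vM scalerA.
Qed.

Lemma spectrum_finite (F : closedFieldType) n (M : 'M[F]_n) :
  finite_set [set l | eigenvalue M l].
Proof.
have [r rE] := closed_field_poly_normal (char_poly M).
apply: (sub_finite_set _ (finite_seq r)) => l /=.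
rewrite eigenvalue_root_char rE (monicP (char_poly_monic M)) scale1r.
by rewrite root_prod_XsubC.
Qed.

(** * The truncated exponential near the origin *)

Lemma map_taylor_exp (F K : fieldType) (f : {rmorphism F -> K}) p :
  map_poly f (taylor_exp F p) = taylor_exp K p.
Proof.
apply/polyP => k; rewrite coef_map !coef_poly.
case: ifP => _; last by rewrite raddf0.
by rewrite /= fmorphV rmorph_nat.
Qed.

Lemma taylor_exp_order2 (F : fieldType) p : (1 <= p)%N ->
  exists r, taylor_exp F p = 1 + 'X + 'X^2 * r.
Proof.
move=> p1; exists (drop_poly 2 (taylor_exp F p)).
rewrite -[LHS](poly_take_drop 2) mulrC; congr (_ + _); apply/polyP => k.
rewrite coef_take_poly coefD coef1 coefX coef_poly.
by case: k => [|[|k]] /=; rewrite ?ltnS ?p1 ?invr1 ?add0r ?addr0.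
Qed.

Lemma horner_norm_le (F : numFieldType) (r : {poly F}) (a : F) :
  exists2 m, 0 <= m & forall z, `|z| <= `|a| -> `|r.[z]| <= m.
Proof.
exists (\sum_(k < size r) `|r`_k| * `|a| ^+ k).
  by apply: sumr_ge0 => k _; rewrite mulr_ge0 ?exprn_ge0.
move=> z za; rewrite horner_coef (le_trans (ler_norm_sum _ _ _))//.
apply: ler_sum => k _; rewrite normrM normrX ler_wpM2l//.
by rewrite lerXn2r ?nnegrE.
Qed.

(** The triangle inequality would only give 1 + |z|, which is too weak when
Re z < 0.  From the first-order behaviour of the square root,
|1 + z| <= 1 + Re z + O(|z|^2); the bound on Re z makes the constant 1
suffice. *)
Lemma norm_1D_le (R : realType) (z : R[i]) : - (1 / 2) <= complex.Re z ->
  `|1 + z| <=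
  (1 + complex.Re z + (complex.Re z ^+ 2 + complex.Im z ^+ 2))%:C.
Proof.
move=> az; case: z az => a b /= az.
have pos : 0 <= 1 + a + (a ^+ 2 + b ^+ 2) by nra.
rewrite -(@ler_pXn2r _ 2)// ?nnegrE ?lec0R//; last by rewrite ler0c.
rewrite -add_Re2_Im2 -rmorphXn /= lecR /=.
rewrite add0r; nra.
Qed.

Definition sign_modulus (R : realType) (p : nat) (lambda : R[i]) (tau : R) :=
  forall t : R, 0 < t < tau ->
    (complex.Re lambda < 0 -> `|(taylor_exp R[i] p).[t%:C * lambda]| < 1) /\
    (0 < complex.Re lambda -> 1 < `|(taylor_exp R[i] p).[t%:C * lambda]|).

(** With a = Re lambda, the modulus of T_p(t lambda) is at most
1 + t a + t^2 (|lambda|^2 + m) and at least 1 + t a - t^2 m, where t^2 m bounds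
the terms of degree at least 2; the linear term t a wins for small t. *)
Lemma taylor_exp_modulus (R : realType) p (lambda : R[i]) : (1 <= p)%N ->
  complex.Re lambda != 0 ->
  exists2 tau : R, 0 < tau & sign_modulus p lambda tau.
Proof.
move=> p1 l0; have [r rE] := taylor_exp_order2 R[i] p1.
have [M M0 rM] := horner_norm_le r lambda.
set a := complex.Re lambda in l0 *; pose L := a ^+ 2 + complex.Im lambda ^+ 2.
have L_ge : a ^+ 2 <= L by rewrite lerDl sqr_ge0.
pose m := L * complex.Re M.
have m0 : 0 <= m.
  rewrite mulr_ge0 ?addr_ge0 ?sqr_ge0//.
  by move: M0; rewrite lecE => /andP[].
have ME : M = (complex.Re M)%:C by rewrite RRe_real// ger0_real.
have restM t : 0 < t <= 1 ->
    `|('X^2 * r).[t%:C * lambda]| <= (t ^+ 2 * m)%:C.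
  move=> /andP[t0 t1]; rewrite hornerM hornerXn normrM normrX normrM.
  rewrite normc_def /= expr0n addr0 sqrtr_sqr (gtr0_norm t0).
  rewrite exprMn -add_Re2_Im2 -/a -/L /m mulrA rmorphM /= -rmorphXn -rmorphM /=.
  apply: ler_pM => //.
    by rewrite ler0c mulr_ge0 ?sqr_ge0// (le_trans _ L_ge)// sqr_ge0.
  rewrite -ME; apply: rM.
  rewrite normrM normc_def /= expr0n addr0 sqrtr_sqr (gtr0_norm t0).
  by rewrite ler_piMl// -[1]/(1%:C) lecR.
have TE t : (taylor_exp R[i] p).[t%:C * lambda]
    = (1 + t%:C * lambda) + ('X^2 * r).[t%:C * lambda].
  by rewrite rE !hornerD hornerC hornerX.
have ReE t : complex.Re (t%:C * lambda) = t * a.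
  by rewrite /a; case: (lambda) => x y /=; rewrite mul0r subr0.
have ImE t : complex.Im (t%:C * lambda) = t * complex.Im lambda.
  by case: (lambda) => x y /=; rewrite mul0r addr0.
have D0 : 0 < 2 * (L + m + 1) by have := sqr_ge0 a; lra.
(* As a^2 <= L, the factor 2 makes t |a| <= 1/2, as norm_1D_le requires. *)
exists (Num.min 1 (`|a| / (2 * (L + m + 1)))).
  by rewrite lt_min ltr01 divr_gt0// normr_gt0.
move=> t /andP[t0]; rewrite lt_min ltr_pdivlMr// => /andP[t1 ta].
have {}restM := restM t; rewrite t0 (ltW t1) in restM.
have {}restM := restM isT.
rewrite TE; split=> a0.
  rewrite ltr0_norm// in ta.
  have half : - (1 / 2) <= t * a by nra.
  rewrite (le_lt_trans (ler_normD _ _))//.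
  have := lerD (@norm_1D_le _ (t%:C * lambda) _) restM.
  rewrite ReE ImE => /(_ half) /le_lt_trans -> //.
  rewrite -rmorphD /= -[ltRHS]/(1%:C) ltcR.
  have -> : (t * a) ^+ 2 + (t * complex.Im lambda) ^+ 2 = t ^+ 2 * L.
    by rewrite /L; ring.
  nra.
rewrite gtr0_norm// in ta.
have := normc_ge_Re (1 + t%:C * lambda); rewrite raddfD /= ReE => lower.
rewrite (lt_le_trans _ (lerB_normD _ _))//.
rewrite (lt_le_trans _ (lerB lower restM))// -rmorphB /= -[ltLHS]/(1%:C) ltcR.
rewrite ger0_norm; nra.
Qed.

Lemma common_sign_modulus (R : realType) p (Omega : set R[i]) : (1 <= p)%N ->
  finite_set Omega ->
  (forall lambda, Omega lambda -> complex.Re lambda != 0) ->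
  exists2 tau : R, 0 < tau &
    forall lambda, Omega lambda -> sign_modulus p lambda tau.
Proof.
move=> p1 /finite_seqP[r ->]; elim: r => [|l r IH] r0.
  by exists 1.
have [l' lr|tau tau0 rtau] := IH; first by apply: r0; rewrite /= inE lr orbT.
have [|tau' tau'0 ltau] := @taylor_exp_modulus R p l p1.
  by apply: r0; rewrite /= inE eqxx.
exists (Num.min tau tau') => [|l']; first by rewrite lt_min tau0.
rewrite /= inE => /orP[/eqP->|lr] t /andP[t0]; rewrite lt_min => /andP[t1 t2].
  by apply: ltau; rewrite t0.
by apply: (rtau l' lr); rewrite t0.
Qed.

(** * Spectrum of the linearized scheme *)

Lemma equilibria_spectrum_finite (R : realType) n
    (f : 'rV[R]_n -> 'rV[R]_n) :
  finite_set (equilibria f) -> finite_set (equilibria_spectrum f).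
Proof.
by move=> fin; apply: bigcup_finite => // y _; exact: spectrum_finite.
Qed.

Lemma jac_spectrum_step (R : realType) (n s : nat) (A : 'M[R]_s)
    (b : 'rV[R]_s) (phi : R -> R) (h : R) (f : 'rV[R]_n -> 'rV[R]_n)
    (y : 'rV[R]_n) (mu : R[i]) :
  f y = 0 -> differentiable f y -> phi h != 0 ->
  jac_spectrum (enrk_step A b phi f h) y mu <->
  exists2 lambda, jac_spectrum f y lambda &
    (map_poly (real_complex R) (stability_poly A b)).[(phi h)%:C * lambda]
      = mu.
Proof.
case: n f y => [|n] f y fy dfy phi0.
  (* A matrix of size 0 has no eigenvalue. *)
  have empty g l : ~ @jac_spectrum R 0 g y l.
    by move=> /eigenvalueP[v _ /eqP[]]; exact: thinmx0.
  by split=> [/empty|[l /empty]].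
have phiC0 : (phi h)%:C != 0 :> R[i] by rewrite (fmorph_eq0 (real_complex R)).
rewrite /jac_spectrum /= jacobian_step// map_horner_mx map_mxZ.
apply: (iff_trans (horner_mx_spectrum _ _ _)); split=> -[l lJ <-].
  exists (l / (phi h)%:C); last by rewrite mulrC divfK.
  by rewrite -(eigenvalueZ _ _ phiC0) mulrC divfK.
by exists ((phi h)%:C * l); [rewrite (eigenvalueZ _ _ phiC0)|].
Qed.

(** * The threshold *)

(** Choosing the bound as a function of p and the spectrum makes it independent
of f, of the dimension and of the tableau.  The default value 1 is taken only
for spectra without a common bound. *)
Definition stability_threshold (R : realType) (p : nat)
    (Omega : set R[i]) : R :=
  xget 1 [set tau | 0 < tau /\
                    forall lambda, Omega lambda -> sign_modulus p lambda tau].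

Theorem theorem1 (R : realType) :
  exists phistar : nat -> set R[i] -> R,
  forall (n : nat) (f : 'rV[R]_n -> 'rV[R]_n)
         (s p : nat) (A : 'M[R]_s) (b : 'rV[R]_s),
    (forall y : 'rV[R]_n, differentiable f y) ->
    finite_set (equilibria f) ->
    (forall lambda, equilibria_spectrum f lambda -> complex.Re lambda != 0) ->
    (1 <= s)%N ->
    explicit_tableau A ->
    has_order A b p ->
    p = s ->
    0 < phistar p (equilibria_spectrum f) /\
    forall phi : R -> R,
      denominator_function phi ->
      (forall h : R, 0 < h -> 0 < phi h < phistar p (equilibria_spectrum f)) ->
      elementary_stable f (fun h y => enrk_step A b phi f h y).

Proof.
exists (@stability_threshold R) => n f s p A b df fin ReN0 s1 _ [ord _] ps.
move: ord; rewrite {}ps => /stability_poly_exp Pexp {p}.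
set Omega := equilibria_spectrum f in ReN0 *.
have [tau tau0 good] :=
  common_sign_modulus s1 (equilibria_spectrum_finite fin) ReN0.
rewrite /stability_threshold.
case: xgetP => [tau' _ [tau'0 good']|/(_ tau) []//].
split; first exact: tau'0.
move=> phi _ phi_lt h h0 y fy.
have /andP[phi0 _] := phi_lt h h0.
have step_spec mu : jac_spectrum (enrk_step A b phi f h) y mu <->
    exists2 lambda, jac_spectrum f y lambda &
      (taylor_exp R[i] s).[(phi h)%:C * lambda] = mu.
  rewrite -(map_taylor_exp (real_complex R)) -Pexp.
  by apply: jac_spectrum_step => //; rewrite gt_eqF.
have modulus lambda : jac_spectrum f y lambda ->
    (complex.Re lambda < 0 ->
       `|(taylor_exp R[i] s).[(phi h)%:C * lambda]| < 1) /\
    (0 < complex.Re lambda ->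
       1 < `|(taylor_exp R[i] s).[(phi h)%:C * lambda]|).
  by move=> lJ; apply: (good' lambda _ _ (phi_lt h h0)); exists y.
split; first exact: step_at_equilibrium.
- move=> stable mu /step_spec[l lJ <-].
  by have [+ _] := modulus l lJ; apply; exact: stable.
- move=> [l lJ l0]; exists ((taylor_exp R[i] s).[(phi h)%:C * l]).
    by apply/step_spec; exists l.
  by have [_ +] := modulus l lJ; apply.
Qed.
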